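(* Let $\varepsilon>0$ and let $\phi_1,\dots,\phi_m\in L^2(I)$ be linearly independent functions, where each $\phi_j:I\to\mathbb{R}$. Let $U_f:=\{f_a:=\sum_{j=1}^m a_j\phi_j \;:\; a=(a_1,\dots,a_m)\in\mathbb{R}^m\}$, equipped with the $L^2$ metric $\mathrm{dist}_2$. Let $\Sigma^{-1}$ be the $m\times m$ matrix with entries $[\Sigma^{-1}]_{j,l}=\int_I\phi_j(t)\phi_l(t)\,dt$ for $j,l\in\{1,\dots,m\}$. Then the mechanism that, on input $f_a\in U_f$, releases $f_{\tilde a}$, where $\tilde a=M(a):=a+\frac{1}{\varepsilon}\Sigma^{1/2}Z$ and $Z\sim\mathrm{SLap}(m)$, is $\varepsilon$-GP with respect to $\mathrm{dist}_2$.
   Context: $I=I_1\times\cdots\times I_d$ with each $I_i\subseteq\mathbb{R}$ (measurable); $L^2(I)$ is the space of square-integrable functions on $I$ (functions equal almost everywhere are identified), and $\mathrm{dist}_2(f,g):=\left(\int_I (f(t)-g(t))^2\,dt\right)^{1/2}$. Because the $\phi_j$ are linearly independent, $a\mapsto f_a$ is a bijection $\mathbb{R}^m\to U_f$; measurable subsets of $U_f$ are the images of measurable subsets of $\mathbb{R}^m$ under it. $\Sigma$ denotes the inverse of the (positive definite) matrix $\Sigma^{-1}$, and $\Sigma^{1/2}$ its symmetric positive definite square root. $\mathrm{SLap}(m)$ is the standard $m$-dimensional spherical Laplace distribution on $\mathbb{R}^m$, with density $h(z)\propto e^{-\|z\|}$ ($\|\cdot\|$ the Euclidean norm). A randomized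 mechanism $M:U\to V$ on a metric space $(U,\mathrm{dist})$ is $\varepsilon$-GP ($\varepsilon$-geo-private) if for all $x,x'\in U$ and all measurable $S\subseteq V$, $\Pr[M(x)\in S]\le e^{\varepsilon\,\mathrm{dist}(x,x')}\Pr[M(x')\in S]$. *)

(* Defs.v *)
From HB Require Import structures.
From mathcomp Require Import all_boot all_order all_algebra.
From mathcomp Require Import all_classical all_reals all_analysis.
From mathcomp Require Import measurable_realfun.

Set Implicit Arguments.
Unset Strict Implicit.
Unset Printing Implicit Defensive.

Import Order.TTheory GRing.Theory Num.Theory.
Import numFieldNormedType.Exports.

Local Open Scope classical_set_scope.
Local Open Scope ring_scope.

(* R^n is [n.-tuple R], which carries in the library the product of the Borel
   sigma-algebras of R. *)

Section lebesgue_measure_tuple.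
Context {R : realType}.

Definition tcons n (x : measurableTypeR R * n.-tuple R) : n.+1.-tuple R :=
  [tuple of x.1 :: x.2].

Lemma measurable_tcons n : measurable_fun [set: measurableTypeR R * n.-tuple R] (@tcons n).
Proof. exact: measurable_cons. Qed.

Section tcons_measure.
Variables (n : nat)
  (mu : {sigma_finite_measure set (measurableTypeR R) -> \bar R})
  (nu : {sigma_finite_measure set n.-tuple R -> \bar R}).

Definition tcons_measure := pushforward (mu \x nu)%E (@tcons n).

Let tcons_measure0 : tcons_measure set0 = 0%E.
Proof. by rewrite /tcons_measure /pushforward preimage_set0 measure0. Qed.

Let tcons_measure_ge0 A : (0 <= tcons_measure A)%E.
Proof. exact: (@measure_ge0 _ _ _ (mu \x nu)%E). Qed.

Let tcons_measure_sigma_additive : semi_sigma_additive tcons_measure.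
Proof.
exact: (@measure_semi_sigma_additive _ _ _
  (measure_function_pushforward__canonical__measure_function_Measure
     (mu \x nu)%E (@measurable_tcons n))).
Qed.

HB.instance Definition _ := isMeasure.Build _ _ _ tcons_measure
  tcons_measure0 tcons_measure_ge0 tcons_measure_sigma_additive.

Let tcons_measure_sigma_finite : sigma_finite setT tcons_measure.
Proof.
have /sigma_finiteP[F [UF ndF Foo]] := sigma_finiteT mu.
have /sigma_finiteP[G [UG ndG Goo]] := sigma_finiteT nu.
pose g (t : n.+1.-tuple R) := (thead t, [tuple of behead t]).
have gK : cancel (@tcons n) g.
  by case=> x t; rewrite /g /tcons theadE; congr pair; exact/val_inj.
have Kg : cancel g (@tcons n).
  by move=> t; apply/val_inj => /=; rewrite [in RHS](tuple_eta t).
have mg : measurable_fun setT g.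
  by apply/measurable_fun_pairP; split;
    [exact: measurable_tnth|exact: measurable_behead].
have gE k : @tcons n @^-1` (g @^-1` (F k `*` G k)) = F k `*` G k.
  by rewrite -comp_preimage (_ : g \o _ = id)//; apply/funext => x; exact: gK.
exists (fun k => g @^-1` (F k `*` G k)).
  rewrite -preimage_bigcup (_ : \bigcup_k _ = setT) ?preimage_setT//.
  apply/seteqP; split=> // -[x t] _.
  have [i _ Fx] : (\bigcup_i F i) x by rewrite -UF.
  have [j _ Gt] : (\bigcup_j G j) t by rewrite -UG.
  exists (maxn i j) => //; split.
  - by move: x Fx; exact/subsetPset/ndF/leq_maxl.
  - by move: t Gt; exact/subsetPset/ndG/leq_maxr.
move=> k; have [mF Fk] := Foo k; have [mG Gk] := Goo k; split.
  by rewrite -[X in measurable X]setTI; apply: mg => //; exact: measurableX.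
rewrite /tcons_measure /pushforward gE product_measure1E//.
by rewrite lte_mul_pinfty// ge0_fin_numE.
Qed.

HB.instance Definition _ := Measure_isSigmaFinite.Build _ _ _ tcons_measure
  tcons_measure_sigma_finite.

End tcons_measure.

(* n-dimensional Lebesgue measure *)
Fixpoint lebesgue_tuple n : {sigma_finite_measure set n.-tuple R -> \bar R} :=
  match n with
  | 0 => \d_[tuple]
  | k.+1 => tcons_measure lebesgue_measure (lebesgue_tuple k)
  end.

End lebesgue_measure_tuple.


Section box.
Context {R : realType} {d : nat} (I_ : 'I_d -> set R).

Definition box : set (d.-tuple R) := [set t | forall i, I_ i (tnth t i)].

Lemma measurable_box : (forall i, measurable (I_ i)) -> measurable box.
Proof.
move=> mI; rewrite (_ : box = \bigcap_(i in setT) ((@tnth d R)^~ i @^-1` I_ i)).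
  apply: fin_bigcap_measurable => // i _.
  by rewrite -[X in measurable X]setTI; exact: measurable_tnth.
by apply/seteqP; split=> t h i; [move=> _; exact: h|exact: (h i)].
Qed.

(* Lebesgue measure on [box]: its integrals over the whole space are the
   integrals over [box], and its null sets are the sets null inside [box] *)
Definition lebesgue_box (mI : forall i, measurable (I_ i)) :=
  mrestr (lebesgue_tuple d) (measurable_box mI).

HB.instance Definition _ mI := Measure.on (lebesgue_box mI).

End box.

Lemma lebesgue_tuple_box (R : realType) n (I_ : 'I_n -> set R) :
  (forall i, measurable (I_ i)) ->
  lebesgue_tuple n (box I_) = (\prod_(i < n) lebesgue_measure (I_ i))%E.
Proof.
elim: n I_ => [|n IHn] I_ mI.
  by rewrite big_ord0 /= diracE mem_set// => -[].
rewrite big_ord_recl -(IHn (fun i => I_ (lift ord0 i)))//.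
rewrite -product_measure1E; [|exact: (mI ord0)|exact: measurable_box].
rewrite /= /tcons_measure /pushforward; congr (_ _).
apply/seteqP; split => -[x t] /=.
  move=> h; split=> [|i] /=; first exact: (h ord0).
  by have := h (lift ord0 i); rewrite tnthS.
move=> [xI tI] i; case: (unliftP ord0 i) => [j|] -> //.
by rewrite tnthS; exact: tI.
Qed.

Notation L2fun mu := (LfunType mu (lee1n 2)).

Section span.
Context {d : measure_display} {T : measurableType d} {R : realType}.
Context (mu : {measure set T -> \bar R}) {m : nat} (phi : 'I_m -> L2fun mu).

Definition dist2 (f g : {mfun_ mu, T >-> R}) : R :=
  Num.sqrt (\int[mu]_t ((f t - g t) ^+ 2))%R.

(* This is the matrix called Sigma^-1; Sigma itself is [invmx gram]. *)
Definition gram : 'M[R]_m :=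
  \matrix_(j, l) (\int[mu]_t (phi j t * phi l t))%R.

Definition lincomb (a : m.-tuple R) : L2fun mu := \sum_j tnth a j *: phi j.

Definition lin_indep : Prop :=
  forall a, (lincomb a : T -> R) = cst 0 %[ae mu] -> forall j, tnth a j = 0.

(* The function f_a up to equality almost everywhere *)
Definition class_lincomb (a : m.-tuple R) : {mfun_ mu, T >-> R} :=
  (\pi_({mfun_ mu, T >-> R}) (lincomb a : {mfun T >-> R}))%qT.

Definition Uf : Type := set_type (range class_lincomb).

Definition to_Uf (a : m.-tuple R) : Uf :=
  exist _ (class_lincomb a) (mem_set (imageT class_lincomb a)).

HB.instance Definition _ := Choice.on Uf.
HB.instance Definition _ := isPointed.Build Uf (to_Uf (nseq_tuple m 0)).

(* When phi is linearly independent, these sets are exactly the images under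
   [to_Uf] of the measurable subsets of R^m (see [measurable_UfP]). *)
Definition measurable_Uf : set (set Uf) :=
  [set A | measurable (to_Uf @^-1` A)].

Let measurable_Uf0 : measurable_Uf set0.
Proof. by rewrite /measurable_Uf /= preimage_set0. Qed.

Let measurable_UfC A : measurable_Uf A -> measurable_Uf (~` A).
Proof. by rewrite /measurable_Uf /= preimage_setC; exact: measurableC. Qed.

Let measurable_Uf_bigcup (F : (set Uf)^nat) :
  (forall i, measurable_Uf (F i)) -> measurable_Uf (\bigcup_i F i).
Proof.
move=> mF; rewrite /measurable_Uf /= preimage_bigcup.
by apply: bigcupT_measurable => i; exact: mF.
Qed.

HB.instance Definition _ := isMeasurable.Build default_measure_display Uf
  measurable_Uf0 measurable_UfC measurable_Uf_bigcup.

Lemma measurable_to_Uf : measurable_fun [set: m.-tuple R] to_Uf.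
Proof. by move=> _ A mA; rewrite setTI. Qed.

Lemma to_Uf_surj (u : Uf) : exists a, to_Uf a = u.
Proof.
case: u => f fP; have [a _ af] := set_mem fP.
by exists a; exact: val_inj.
Qed.

Lemma to_Uf_inj : lin_indep -> injective to_Uf.
Proof.
move=> li a b /(congr1 val) /= /eqP.
rewrite /class_lincomb eqmodE => /asboolP ab.
have {}ab : (lincomb [tuple tnth a i - tnth b i | i < m] : T -> R)
    = cst 0 %[ae mu].
  have -> : lincomb [tuple tnth a i - tnth b i | i < m]
      = lincomb a - lincomb b.
    rewrite /lincomb -sumrB; apply: eq_bigr => i _.
    by rewrite tnth_mktuple scalerBl.
  apply: filterS ab => t /(_ I) abt _ /=.
  by change (lincomb a t - lincomb b t = 0); rewrite abt subrr.
apply: eq_from_tnth => i.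
by have := li _ ab i; rewrite tnth_mktuple => /subr0_eq.
Qed.

Lemma measurable_UfP : lin_indep -> forall A : set Uf,
  measurable A <-> exists2 B, measurable B & to_Uf @` B = A.
Proof.
move=> li A; split=> [mA|[B mB <-]].
  exists (to_Uf @^-1` A) => //; rewrite image_preimage//.
  by apply/seteqP; split=> // u _; have [a <-] := to_Uf_surj u; exists a.
rewrite /measurable /= /measurable_Uf /= (_ : _ @^-1` _ = B)//.
apply/seteqP; split=> [a [b Bb /(to_Uf_inj li) <-]//|a Ba].
by exists a.
Qed.

(* [xget] picks the unique antecedent (see [to_UfK]); the default value of
   [xget] is never used because [to_Uf] is surjective. *)
Definition coef (u : Uf) : m.-tuple R :=
  xget (nseq_tuple m 0) [set a | to_Uf a = u].

Lemma to_UfK : lin_indep -> cancel to_Uf coef.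
Proof.
move=> li a; apply: (to_Uf_inj li); rewrite /coef.
by case: xgetP => [b _ ->|/(_ a)/(_ erefl)].
Qed.

Definition dist_Uf (u v : Uf) : R := dist2 (val u) (val v).

End span.
Arguments dist_Uf {d T R mu m} phi u v.

Section matrix.
Context {R : realType} {m : nat}.

Definition posdefmx (A : 'M[R]_m) : Prop :=
  A \is symmetricmx /\
  forall v : 'cV[R]_m, v != 0 -> 0 < (v^T *m A *m v) 0 0.

Definition is_sqrtmx (A B : 'M[R]_m) : Prop := posdefmx B /\ B *m B = A.

End matrix.

Section slap.
Context {R : realType} (m : nat).

Definition enorm (z : m.-tuple R) : R := Num.sqrt (\sum_(i < m) tnth z i ^+ 2).

Definition slap_pdf (z : m.-tuple R) : R :=
  expR (- enorm z) / (\int[lebesgue_tuple m]_y expR (- enorm y))%R.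

Definition slap (A : set (m.-tuple R)) : \bar R :=
  (\int[lebesgue_tuple m]_(z in A) (slap_pdf z)%:E)%E.

End slap.

Section mechanism.
Context {R : realType} {d : measure_display} {T : measurableType d}.
Context {mu : {measure set T -> \bar R}} {m : nat} (phi : 'I_m -> L2fun mu).
Context {dO : measure_display} {Omega : measurableType dO}.
Context (eps : R) (S : 'M[R]_m) (Z : {mfun Omega >-> m.-tuple R}).

Definition noisy_coef (a : m.-tuple R) (w : Omega) : m.-tuple R :=
  [tuple tnth a i + eps^-1 * (S *m \col_j tnth (Z w) j) i 0 | i < m].

Lemma measurable_noisy_coef a : measurable_fun [set: Omega] (noisy_coef a).
Proof.
apply/measurable_fun_tnthP => i; rewrite /comp.
under eq_fun do rewrite tnth_mktuple mxE.
apply: measurable_funD => //; apply: measurable_funM => //.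
apply: measurable_sum => j; under eq_fun do rewrite mxE.
apply: measurable_funM => //.
by apply: (measurableT_comp (measurable_tnth j)).
Qed.

Definition mechanism (u : Uf phi) (w : Omega) : Uf phi :=
  to_Uf phi (noisy_coef (coef u) w).

Lemma measurable_mechanism u : measurable_fun [set: Omega] (mechanism u).
Proof.
move=> mO A mA;
exact: (@measurable_noisy_coef (coef u) mO (to_Uf phi @^-1` A) mA).
Qed.

HB.instance Definition _ u := @isMeasurableFun.Build _ _ _ _ (mechanism u)
  (measurable_mechanism u).

End mechanism.
Arguments mechanism {R d T mu m} phi {dO Omega} eps S Z u w.

(* The mechanism is given by one V-valued random variable per input; only the
   law of each of them matters. *)
Definition geo_private (R : realType) (U : Type) (dist : U -> U -> R)
    (dO dV : measure_display) (Omega : measurableType dO)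
    (P : probability Omega R) (V : measurableType dV)
    (M : U -> {mfun Omega >-> V}) (eps : R) : Prop :=
  forall (x x' : U) (S : set V), measurable S ->
    (distribution P (M x) S
     <= (expR (eps * dist x x'))%:E * distribution P (M x') S)%E.

(* Main.v *)
(* Write v = a - b and c = eps Sigma^(-1/2) v.  Adding c to the noise turns the
   output on f_b into the output on f_a, so by translation invariance of Lebesgue
   measure and the triangle inequality the two laws differ by a factor at most
   e^|c|.  Finally |c|^2 = eps^2 v^T Sigma^-1 v = eps^2 dist2(f_a, f_b)^2. *)

Require Import Defs.
From HB Require Import structures.
From mathcomp Require Import all_boot all_order all_algebra.
From mathcomp Require Import all_classical all_reals all_analysis.
From mathcomp Require Import measurable_realfun ring lra.

Set Implicit Arguments.
Unset Strict Implicit.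
Unset Printing Implicit Defensive.

Import Order.TTheory GRing.Theory Num.Theory.
Import numFieldNormedType.Exports.

Local Open Scope classical_set_scope.
Local Open Scope ring_scope.

(** * Translation invariance of Lebesgue measure *)

Definition addt (R : realType) n (c z : n.-tuple R) : n.-tuple R :=
  [tuple tnth z i + tnth c i | i < n].

Lemma measurable_addt (R : realType) n (c : n.-tuple R) :
  measurable_fun [set: n.-tuple R] (addt c).
Proof.
apply/measurable_fun_tnthP => i; rewrite /comp.
under eq_fun do rewrite tnth_mktuple.
by apply: measurable_funD => //; exact: measurable_tnth.
Qed.

Lemma addtK (R : realType) n (c : n.-tuple R) :
  cancel (addt c) (addt [tuple - tnth c i | i < n]).
Proof. by move=> z; apply: eq_from_tnth => i; rewrite !tnth_mktuple addrK. Qed.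

(** The pushforward by a translation preserves the length of every half-open interval, and Lebesgue
    measure is the only measure that does so. *)
Lemma lebesgue_measure_shift (R : realType) (c : R)
    (A : set (measurableTypeR R)) : measurable A ->
  lebesgue_measure (+%R^~ c @^-1` A) = lebesgue_measure A.
Proof.
move=> mA; apply/esym.
have mc : measurable_fun [set: measurableTypeR R]
    (+%R^~ c : measurableTypeR R -> measurableTypeR R).
  by apply: measurable_funD.
apply: (lebesgue_measure_unique
  (mu := measure_function_pushforward__canonical__measure_function_Measure
     lebesgue_measure mc)) mA => _ [[a b] _ <-] /=.
rewrite /pushforward (_ : +%R^~ c @^-1` _ = `]a - c, b - c]%classic); last first.
  by apply/seteqP; split=> x /=; rewrite !in_itv/= ltrBlDr lerBrDr.
rewrite !lebesgue_measure_itv/= !lte_fin ltrD2r.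
by case: ifPn => // _; rewrite -!EFinB opprB addrA subrK.
Qed.

(** Induction on the dimension: the product measure integrates the measures of sections. The
    induction hypothesis absorbs the shift of the tail inside each section, and the one-dimensional
    case absorbs the shift of the head. *)
Lemma lebesgue_tuple_addt (R : realType) n (c : n.-tuple R)
    (A : set (n.-tuple R)) :
  measurable A -> lebesgue_tuple n (addt c @^-1` A) = lebesgue_tuple n A.
Proof.
elim: n c A => [|n IHn] c A mA.
  congr (_ _); apply/seteqP.
  by split=> z /=; rewrite (tuple0 z) (tuple0 (addt _ _)).
pose c0 := thead c; pose c1 := [tuple of behead c].
have mtA : measurable (@tcons R n @^-1` A).
  by rewrite -[X in measurable X]setTI; exact: measurable_tcons.
rewrite /= /tcons_measure /pushforward /product_measure1.
pose F x := lebesgue_tuple n (xsection (@tcons R n @^-1` A) x).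
have mF : measurable_fun setT F by exact: measurable_fun_xsection.
have mc : measurable_fun [set: measurableTypeR R]
    (+%R^~ c0 : measurableTypeR R -> measurableTypeR R).
  by apply: measurable_funD.
(* The section at [x] of the translated set is the [c1]-translate of the section of the original set
   at [x + c0]. *)
transitivity (\int[lebesgue_measure]_x (F \o +%R^~ c0) x)%E.
  apply: eq_integral => x _ /=; rewrite /F -[in RHS](IHn c1);
    last exact: measurable_xsection.
  congr (_ _); apply/seteqP.
  suff h t : addt c (tcons (x, t)) = tcons (x + c0, addt c1 t).
    by split=> t; rewrite /xsection/= !inE/= h.
  apply: eq_from_tnth => i; rewrite tnth_mktuple.
  case: (unliftP ord0 i) => [j|] ->.
    rewrite !tnthS !tnth_mktuple tnth_behead; congr (_ + tnth c _).
    by apply: val_inj; rewrite /= inordK ?ltnS.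
  by rewrite !tnth0.
(* Writing the whole line as a preimage puts the integral in the form required by the change of
   variables. *)
rewrite -[LHS]/(\int[lebesgue_measure]_(x in +%R^~ c0 @^-1` setT)
  (F \o +%R^~ c0) x)%E.
rewrite -(ge0_integral_pushforward mc)//.
apply: eq_measure_integral => B mB _.
exact: lebesgue_measure_shift.
Qed.

(** * Euclidean norm: Cauchy-Schwarz and triangle inequalities *)

Lemma enorm_sqr (R : realType) n (z : n.-tuple R) :
  enorm z ^+ 2 = \sum_(i < n) tnth z i ^+ 2.
Proof. by rewrite sqr_sqrtr// sumr_ge0// => i _; exact: sqr_ge0. Qed.

(** Expanding $\sum_i (|y| x_i - |x| y_i)^2 \ge 0$ gives the inequality multiplied by $2|x||y|$. The
    vectors of norm zero are treated apart so that this factor can be cancelled. *)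
Lemma sum_mul_le_enorm (R : realType) n (x y : n.-tuple R) :
  \sum_(i < n) tnth x i * tnth y i <= enorm x * enorm y.
Proof.
have enorm_eq0 (z : n.-tuple R) : enorm z = 0 -> forall i, tnth z i = 0.
  move=> z0 i; apply/eqP; rewrite -sqrf_eq0.
  have /esym/eqP := enorm_sqr z; rewrite z0 expr0n/=.
  by rewrite psumr_eq0 => [/allP/(_ i (mem_index_enum i))//|j _]; exact: sqr_ge0.
have [x0|xN0] := eqVneq (enorm x) 0.
  by rewrite x0 mul0r big1// => i _; rewrite enorm_eq0// mul0r.
have [y0|yN0] := eqVneq (enorm y) 0.
  by rewrite y0 mulr0 big1// => i _; rewrite [tnth y i]enorm_eq0// mulr0.
have x_gt0 : 0 < enorm x by rewrite lt0r xN0 sqrtr_ge0.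
have y_gt0 : 0 < enorm y by rewrite lt0r yN0 sqrtr_ge0.
have : 0 <= \sum_(i < n) (enorm y * tnth x i - enorm x * tnth y i) ^+ 2.
  by apply: sumr_ge0 => i _; exact: sqr_ge0.
have sqrE i : (enorm y * tnth x i - enorm x * tnth y i) ^+ 2
    = enorm y ^+ 2 * tnth x i ^+ 2
      - 2 * (enorm x * enorm y) * (tnth x i * tnth y i)
      + enorm x ^+ 2 * tnth y i ^+ 2 by ring.
under eq_bigr do rewrite sqrE.
rewrite big_split/= sumrB -!mulr_sumr -!enorm_sqr => xy_ge0.
rewrite -(ler_pM2l (_ : 0 < 2 * (enorm x * enorm y))) ?mulr_gt0//; lra.
Qed.

Lemma enorm_addt (R : realType) n (c z : n.-tuple R) :
  enorm (addt c z) <= enorm z + enorm c.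
Proof.
have e0 (t : n.-tuple R) : 0 <= enorm t by exact: sqrtr_ge0.
rewrite -(ler_pXn2r (_ : 0 < 2)%N) ?nnegrE ?addr_ge0//.
have sqrE i : tnth (addt c z) i ^+ 2
    = tnth z i ^+ 2 + 2 * (tnth z i * tnth c i) + tnth c i ^+ 2.
  by rewrite tnth_mktuple; ring.
rewrite sqrrD !enorm_sqr.
under eq_bigr do rewrite sqrE.
rewrite !big_split/= -mulr_sumr lerD2r lerD2l -[leRHS]mulr_natl ler_pM2l//.
exact: sum_mul_le_enorm.
Qed.

Lemma measurable_enorm (R : realType) n :
  measurable_fun [set: n.-tuple R] (@enorm R n).
Proof.
apply: measurableT_comp => //.
  by apply: continuous_measurable_fun; exact: sqrt_continuous.
apply: measurable_sum => i; apply: measurable_funX; exact: measurable_tnth.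
Qed.

(** * Spherical Laplace distribution under translation *)

Lemma slap_pdf_ge0 (R : realType) n (z : n.-tuple R) : 0 <= slap_pdf z.
Proof.
by rewrite divr_ge0 ?expR_ge0//; apply: Rintegral_ge0 => y _; exact: expR_ge0.
Qed.

Lemma measurable_slap_pdf (R : realType) n :
  measurable_fun [set: n.-tuple R] (@slap_pdf R n).
Proof.
apply: measurable_funM => //; apply: measurableT_comp => //.
by apply: measurable_funN; exact: measurable_enorm.
Qed.

(** A change of variables moves the translation from the set to the density, where the factor
    $e^{|c|}$ bounds it pointwise. *)
Lemma slap_addt (R : realType) n (c : n.-tuple R) (A : set (n.-tuple R)) :
  measurable A ->
  (slap (addt c @^-1` A) <= (expR (enorm c))%:E * slap A)%E.
Proof.
move=> mA; have mc := measurable_addt c.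
pose c' : n.-tuple R := [tuple - tnth c i | i < n].
have mpdf := @measurable_slap_pdf R n.
have mpdfc : measurable_fun setT (fun y => (slap_pdf (addt c' y))%:E).
  by apply/measurable_EFinP; apply: measurableT_comp => //; exact: measurable_addt.
have -> : slap (addt c @^-1` A)
    = (\int[lebesgue_tuple n]_(y in A) (slap_pdf (addt c' y))%:E)%E.
  transitivity (\int[pushforward (lebesgue_tuple n) (addt c)]_(y in A)
      (slap_pdf (addt c' y))%:E)%E; last first.
    apply: eq_measure_integral => B mB _; exact: lebesgue_tuple_addt.
  rewrite (ge0_integral_pushforward mc _ mA).
  - by apply: eq_integral => z _ /=; rewrite addtK.
  - exact: measurable_funTS.
  - by move=> y _; rewrite lee_fin slap_pdf_ge0.
rewrite /slap -ge0_integralZl//; first last.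
- by move=> y _; rewrite lee_fin slap_pdf_ge0.
- by apply: measurable_funTS; exact/measurable_EFinP.
apply: ge0_le_integral => //.
- by move=> y _; rewrite lee_fin slap_pdf_ge0.
- exact: measurable_funTS.
- by apply: measurable_funTS; apply/measurable_EFinP; exact: measurable_funM.
move=> y _; rewrite -EFinM lee_fin mulrA -expRD ler_wpM2r//.
  by rewrite invr_ge0; apply: Rintegral_ge0 => z _; exact: expR_ge0.
(* What remains is $|y| \le |y - c| + |c|$. *)
rewrite ler_expR lerBrDl lerBlDl.
have := enorm_addt c (addt c' y).
suff -> : addt c (addt c' y) = y by rewrite addrC.
by apply: eq_from_tnth => i; rewrite !tnth_mktuple subrK.
Qed.

(** * Gram matrix and the $L^2$ distance *)

Lemma Rintegral_sum d (T : measurableType d) (R : realType)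
    (mu : {measure set T -> \bar R}) (D : set T) (I : Type) (s : seq I)
    (f : I -> T -> R) :
  measurable D -> (forall i, mu.-integrable D (EFin \o f i)) ->
  (\int[mu]_(x in D) (\sum_(i <- s) f i x) =
   \sum_(i <- s) \int[mu]_(x in D) f i x)%R.
Proof.
move=> mD intf; elim: s => [|i s ih].
  by under eq_Rintegral do rewrite big_nil; rewrite big_nil Rintegral_cst ?mul0r.
under eq_Rintegral do rewrite big_cons.
rewrite big_cons RintegralD ?ih//.
have -> : EFin \o (fun x => \sum_(j <- s) f j x)
    = (fun x => (\sum_(j <- s) (f j x)%:E)%E).
  by apply/funext => x /=; rewrite sumEFin.
by apply: (integrable_sum mD) => j _; exact: intf.
Qed.

Section gram.
Context {d : measure_display} {T : measurableType d} {R : realType}.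
Context (mu : {measure set T -> \bar R}) {m : nat} (phi : 'I_m -> L2fun mu).

Lemma lincombE (a : m.-tuple R) t :
  lincomb phi a t = \sum_j tnth a j * phi j t.
Proof.
rewrite /lincomb; elim/big_ind2 : _ => //= f x g y.
by move=> <- <-.
Qed.

(** [dist2] evaluates the chosen representative of a class, which is tied to the linear combination
    only almost everywhere. *)
Lemma class_lincomb_ae (a : m.-tuple R) :
  (class_lincomb phi a : T -> R) = lincomb phi a %[ae mu].
Proof.
have /eqP := reprK (class_lincomb phi a).
by rewrite {2}/class_lincomb eqmodE => /asboolP.
Qed.

Lemma integrable_phiM j l :
  mu.-integrable setT (EFin \o (fun t => phi j t * phi l t)).
Proof. by apply/Lfun1_integrable; apply: Lfun2_mul_Lfun1; exact: LfunP. Qed.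

(** The square of $\sum_j v_j \phi_j$ expands into a double sum, which is integrated term by term;
    products of two $L^2$ functions are integrable. *)
Lemma dist_UfE (a b : m.-tuple R) :
  let v : 'cV[R]_m := \col_i (tnth a i - tnth b i) in
  dist_Uf phi (to_Uf phi a) (to_Uf phi b) = Num.sqrt ((v^T *m gram phi *m v) 0 0).
Proof.
move=> v; rewrite /dist_Uf /dist2 /=; congr Num.sqrt.
pose w j l := v j 0 * v l 0.
transitivity (\int[mu]_t (\sum_j \sum_l w j l * (phi j t * phi l t)))%R.
  congr fine; apply: ae_eq_integral => //.
  - apply/measurable_EFinP; apply: measurable_funX; exact: measurable_funB.
  - apply/measurable_EFinP; apply: measurable_sum => j.
    apply: measurable_sum => l.
    by apply: measurable_funM => //; exact: measurable_funM.
  have := class_lincomb_ae a; have := class_lincomb_ae b.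
  apply: filterS2 => t fb fa _; congr EFin.
  rewrite (fa I) (fb I) !lincombE -sumrB expr2 big_distrl/=.
  apply: eq_bigr => j _; rewrite big_distrr/=; apply: eq_bigr => l _.
  by rewrite /w /v !mxE; ring.
have iw j l : mu.-integrable setT
    (EFin \o (fun t => w j l * (phi j t * phi l t))).
  exact: (integrableZl measurableT (w j l) (integrable_phiM j l)).
rewrite Rintegral_sum//; last first.
  move=> j; have -> : EFin \o (fun t => \sum_l w j l * (phi j t * phi l t))
      = (fun t => (\sum_l (w j l * (phi j t * phi l t))%:E)%E).
    by apply/funext => t /=; rewrite sumEFin.
  by apply: (integrable_sum measurableT) => l _; exact: iw.
rewrite mxE; under [RHS]eq_bigr do rewrite mxE big_distrl/=.
rewrite [RHS]exchange_big; apply: eq_bigr => j _.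
rewrite Rintegral_sum//; apply: eq_bigr => l _.
rewrite (RintegralZl _ measurableT (integrable_phiM j l))
  [v^T _ _]mxE [gram phi _ _]mxE.
by rewrite /w mulrAC.
Qed.

End gram.

(** A nonzero kernel vector would make the quadratic form vanish. *)
Lemma posdefmx_unit (R : realType) m (B : 'M[R]_m) : posdefmx B -> B \in unitmx.
Proof.
move=> [_ Bpos]; rewrite -row_free_unit; apply: inj_row_free => v vB0.
apply/eqP/negPn/negP => v0.
have vT0 : v^T != 0.
  by apply: contra_neq v0 => vT0; rewrite -[v]trmxK vT0 trmx0.
by have := Bpos _ vT0; rewrite trmxK vB0 mul0mx mxE ltxx.
Qed.

(** Since $B$ is symmetric with $B^2 = G^{-1}$, one has $G = (B^{-1})^T B^{-1}$, hence $v^T G v =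
    |B^{-1} v|^2$. *)
Lemma enorm_sqrtmx (R : realType) m (G B : 'M[R]_m) (v : 'cV[R]_m) (eps : R) :
  0 <= eps -> is_sqrtmx (invmx G) B ->
  enorm [tuple (eps *: (invmx B *m v)) i 0 | i < m]
  = eps * Num.sqrt ((v^T *m G *m v) 0 0).
Proof.
move=> eps0 [Bpd BB]; have uB := posdefmx_unit Bpd.
have symB : B^T = B.
  by case: Bpd => /is_hermitianmxP symB _; rewrite [RHS]symB expr0 scale1r map_mx_id.
have GE : G = (invmx B)^T *m invmx B.
  (* [invmx] fixes singular matrices, so [B] invertible forces [G] invertible *)
  have uG : G \in unitmx by rewrite -unitmx_inv -BB unitmx_mul uB.
  rewrite trmx_inv symB -[RHS](mulKVmx uG) -BB -(mulmxA B B) (mulKVmx uB).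
  by rewrite mulmxV// mulmx1.
(* As [eps] is nonnegative, it enters the square root as its square. *)
rewrite -[eps in RHS]ger0_norm// -sqrtr_sqr -sqrtrM ?sqr_ge0//; congr Num.sqrt.
rewrite GE mulmxA -trmx_mul -mulmxA mxE mulr_sumr.
by apply: eq_bigr => i _; rewrite tnth_mktuple !mxE; ring.
Qed.

(** * Privacy of the mechanism *)

Theorem theorem3p2 (R : realType) (eps : R) (eps_gt0 : 0 < eps)
    (d : nat) (I_ : 'I_d -> set R) (mI : forall i, measurable (I_ i))
    (m : nat) (phi : 'I_m -> L2fun (lebesgue_box mI))
    (phi_indep : lin_indep phi)
    (sqrtSigma : 'M[R]_m)
    (sqrtSigmaP : is_sqrtmx (invmx (gram phi)) sqrtSigma)
    (dO : measure_display) (Omega : measurableType dO)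
    (P : probability Omega R) (Z : {mfun Omega >-> m.-tuple R})
    (Z_slap : forall A, measurable A -> distribution P Z A = slap A) :
  geo_private (dist_Uf phi) P (mechanism phi eps sqrtSigma Z) eps.
Proof.
move=> x x' S mS.
have [a <-] := to_Uf_surj x; have [b <-] := to_Uf_surj x'.
have mid : measurable_fun [set: m.-tuple R] idfun by exact: measurable_id.
(* With the identity as noise variable, [noisy_coef] becomes a deterministic map of the noise value,
   so [A u] is the set of noise values sending the output on $f_u$ into [S]. *)
pose idm : {mfun m.-tuple R >-> m.-tuple R} :=
  HB.pack (idfun : m.-tuple R -> m.-tuple R)
    (isMeasurableFun.Build _ _ _ _ _ mid).
pose noise := noisy_coef eps sqrtSigma idm.
pose A u := noise u @^-1` (to_Uf phi @^-1` S).
have mA u : measurable (A u).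
  by rewrite /A -[X in measurable X]setTI; exact: measurable_noisy_coef.
have mechE u : distribution P (mechanism phi eps sqrtSigma Z (to_Uf phi u)) S
    = slap (A u).
  rewrite -Z_slap// /distribution /pushforward; congr (P _).
  by apply/seteqP; split=> w; rewrite /= /mechanism to_UfK.
pose v : 'cV[R]_m := \col_i (tnth a i - tnth b i).
pose c : m.-tuple R := [tuple (eps *: (invmx sqrtSigma *m v)) i 0 | i < m].
have AE : A a = addt c @^-1` A b.
  (* Multiplying [c] by $\varepsilon^{-1}\Sigma^{1/2}$ gives back $v = a - b$. *)
  suff noiseE z : noise b (addt c z) = noise a z.
    by apply/seteqP; split=> z; rewrite /A /= noiseE.
  apply: eq_from_tnth => i; rewrite !tnth_mktuple.
  have -> : \col_j tnth (addt c z) j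
      = \col_j tnth z j + eps *: (invmx sqrtSigma *m v).
    by apply/matrixP => j k; rewrite !mxE !tnth_mktuple !mxE ord1.
  rewrite mulmxDr -scalemxAr mulKVmx; last by case: sqrtSigmaP => /posdefmx_unit.
  by rewrite mxE [(eps *: v) i 0]mxE [v i 0]mxE mulrDr mulKf ?gt_eqF//; ring.
rewrite !mechE AE dist_UfE -(enorm_sqrtmx _ (ltW eps_gt0) sqrtSigmaP).
exact: slap_addt.
Qed.
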